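(* Let $\mathbf{X}^n=(x_1^n,x_2^n)$ be generated by the scheme with time step $\Delta t=1/N$ from a deterministic initial point $\mathbf{X}^0\in\mathbb{R}^2$. Then the second moment grows at most linearly: $$\sup_{n\ge1}\ \frac{\mathbb{E}\|\mathbf{X}^n\|^2}{n}<\infty.$$
   Context: Let $\sigma>0$. Let $H(t,x_1,x_2)=H_1(t,x_1)+H_2(t,x_2)$ be a smooth separable Hamiltonian, $1$-periodic in $t,x_1,x_2$, and set $v_1(t,x_2)=-\partial_{x_2}H$, $v_2(t,x_1)=\partial_{x_1}H$; assume $\int_0^1 v_1(t,x_2)\,\mathrm{d}x_2=0$ and $\int_0^1 v_2(t,x_1)\,\mathrm{d}x_1=0$ for all $t$. Let $N\in\mathbb{N}$, $\Delta t=1/N$, $t_{n+\frac12}=(n+\frac12)\Delta t$. The scheme is $$x_1^{n+1}=x_1^n+v_1(t_{n+\frac12},x_2^n)\Delta t+\sigma\sqrt{\Delta t}\,\xi_1^n,\quad x_2^{n+1}=x_2^n+v_2\big(t_{n+\frac12},x_1^n+v_1(t_{n+\frac12},x_2^n)\Delta t\big)\Delta t+\sigma\sqrt{\Delta t}\,\xi_2^n,$$ with $\xi_1^n,\xi_2^n$ i.i.d. $\mathcal{N}(0,1)$. *)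

(* Defs.v *)
From HB Require Import structures.
From mathcomp Require Import all_boot all_order all_algebra.
From mathcomp Require Import all_classical all_reals all_analysis.
Set Implicit Arguments. Unset Strict Implicit. Unset Printing Implicit Defensive.
Import Order.TTheory GRing.Theory Num.Theory.
Import numFieldNormedType.Exports.
Local Open Scope classical_set_scope.
Local Open Scope ring_scope.

Fixpoint Ck {R : realType} (n k : nat) (f : 'rV[R]_n -> R) : Prop :=
  continuous f /\
  match k with
  | 0 => True
  | k'.+1 => forall i : 'I_n,
      (forall x, derivable f x (delta_mx 0 i)) /\
      Ck k' (fun x => 'D_(delta_mx 0 i) f x)
  end.

Definition smooth {R : realType} (n : nat) (f : 'rV[R]_n -> R) : Prop :=
  forall k, Ck k f.

Definition mutually_independent {R : realType} {d : measure_display}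
  {Omega : measurableType d} (P : probability Omega R) (I : eqType)
  (X : I -> Omega -> R) : Prop :=
  forall (s : seq I) (A : I -> set R), uniq s ->
    (forall j, measurable (A j)) ->
    P (\bigcap_(j in [set` s]) (X j @^-1` A j)) =
    (\prod_(j <- s) P (X j @^-1` A j))%E.

Definition std_normal_law {R : realType} {d : measure_display}
  {Omega : measurableType d} (P : probability Omega R) (X : Omega -> R) : Prop :=
  forall A : set R, measurable A -> P (X @^-1` A) = normal_prob 0 1 A.

Definition dtN {R : realType} (N : nat) : R := (N%:R)^-1.
Definition thalf {R : realType} (N n : nat) : R := (n%:R + 2^-1) * dtN N.

Fixpoint scheme {R : realType} {Omega : Type} (v1 v2 : R -> R -> R)
  (sigma : R) (N : nat) (x0 : R * R) (xi1 xi2 : nat -> Omega -> R)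
  (n : nat) (w : Omega) : R * R :=
  match n with
  | 0 => x0
  | m.+1 =>
    let p := scheme v1 v2 sigma N x0 xi1 xi2 m w in
    let t := thalf N m in
    let y := p.1 + v1 t p.2 * dtN N in
    (y + sigma * Num.sqrt (dtN N) * xi1 m w,
     p.2 + v2 t y * dtN N + sigma * Num.sqrt (dtN N) * xi2 m w)
  end.

(* Main.v *)
Require Import Defs.
From HB Require Import structures.
From mathcomp Require Import all_boot all_order all_algebra.
From mathcomp Require Import all_classical all_reals all_analysis.
From mathcomp Require Import measurable_realfun ring lra.
Import Order.TTheory GRing.Theory Num.Theory.
Import numFieldNormedType.Exports.
Local Open Scope classical_set_scope.
Local Open Scope ring_scope.

(* One step of the scheme is X' = Phi(X) + eta, where Phi is a composition of two
   shears, hence preserves Lebesgue measure on the torus, and eta is Gaussian.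
   The displacement Phi(x) - x is bounded, periodic and of mean zero.  The law of
   eta dominates c times the uniform law on the unit square (c > 0), so averaging
   over eta contracts the sup norm of periodic mean-zero functions by 1 - c.
   Hence the Poisson-type recursion psi_k = (Phi_k - id)_i + E psi_(k+1)(Phi_k + eta),
   solved backwards from psi_n = 0, has solutions bounded uniformly in k and n.
   As E[x_i' + psi_(k+1)(X') | X] = x_i + psi_k(X), the second moment of
   x_i + psi_k(X) grows by at most a constant per step. *)

Set Implicit Arguments.
Unset Strict Implicit.
Unset Printing Implicit Defensive.

(** * Bounded measurable functions *)

Section bounded_measurable.
Context {R : realType}.

(** Expanding the second moment of a coordinate directly leaves a cross term between position and
    displacement. The position is unbounded, so boundedness of the displacement alone yields only
    quadratic growth; cancellation over the torus has to enter, and the corrector is what carries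
    it. The velocities change from step to step, so no single stationary Poisson equation is
    available, and the corrector depends on the present time and on the horizon. The torus itself is
    never formed: the chain stays in the plane, where the noise and the second moment live, and
    functions on the torus are 1-periodic functions averaged over the unit square. All test
    functions are bounded and measurable, hence integrable for every probability, which makes
    linearity and Fubini available for the uniform and the Gaussian law alike. *)

Definition bounded_measurable d (T : measurableType d) (f : T -> R) :=
  measurable_fun setT f /\ exists M, forall x, `|f x| <= M.

Lemma bounded_measurable_comp d1 d2 (T1 : measurableType d1)
    (T2 : measurableType d2) (f : T2 -> R) (g : T1 -> T2) :
  bounded_measurable f -> measurable_fun setT g ->
  bounded_measurable (fun x => f (g x)).
Proof.
move=> [mf [M fM]] mg; split; first exact: (measurableT_comp mf mg).
by exists M => x; exact: fM.
Qed.

Lemma bounded_measurableD d (T : measurableType d) (f g : T -> R) :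
  bounded_measurable f -> bounded_measurable g ->
  bounded_measurable (fun x => f x + g x).
Proof.
move=> [mf [M fM]] [mg [K gK]]; split; first exact: measurable_funD.
by exists (M + K) => x; rewrite (le_trans (ler_normD _ _))// lerD.
Qed.

Lemma bounded_measurable_cst d (T : measurableType d) (r : R) :
  bounded_measurable (fun _ : T => r).
Proof. by split; [exact: measurable_cst|exists `|r|]. Qed.

Lemma bounded_measurable_integrable d (T : measurableType d)
    (P : probability T R) (f : T -> R) :
  bounded_measurable f -> P.-integrable setT (EFin \o f).
Proof.
move=> [mf [M fM]]; apply: measurable_bounded_integrable => //.
  by rewrite (le_lt_trans (probability_le1 P _)) ?ltry.
exists M; split; first exact: num_real.
by move=> x Mx y _; exact: le_trans (fM y) (ltW Mx).
Qed.

Lemma Rintegral_probability_cst d (T : measurableType d) (P : probability T R)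
  (r : R) : \int[P]_(_ in setT) r = r.
Proof.
rewrite Rintegral_cst//.
by rewrite -[RHS]mulr1; congr (_ * _); exact: congr1 (probability_setT P).
Qed.

Lemma Rintegral_probability_le d (T : measurableType d) (P : probability T R)
    (f : T -> R) (L : R) : bounded_measurable f ->
  (forall x, `|f x| <= L) -> `|\int[P]_x f x| <= L.
Proof.
move=> bf fL; rewrite -(Rintegral_probability_cst P L).
apply: le_trans (le_normr_Rintegral _ _) _ => //.
  exact: bounded_measurable_integrable.
apply: le_Rintegral => //.
- apply: (@bounded_measurable_integrable _ _ P (fun x => `|f x|)).
  case: bf => mf [M fM]; split; first exact: measurableT_comp.
  by exists M => x; rewrite normr_id.
- by apply: bounded_measurable_integrable; exact: bounded_measurable_cst.
Qed.

Lemma EFin_Rintegral_bounded d (T : measurableType d) (P : probability T R)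
    (f : T -> R) : bounded_measurable f ->
  (\int[P]_x f x)%:E = (\int[P]_x (f x)%:E)%E.
Proof.
move=> bf; rewrite /Rintegral fineK//.
by apply: integrable_fin_num => //; exact: bounded_measurable_integrable.
Qed.

End bounded_measurable.

Section bounded_fubini.
Context {R : realType} d1 d2 (T1 : measurableType d1) (T2 : measurableType d2).
Variables (P1 : probability T1 R) (P2 : probability T2 R).
Variable f : T1 * T2 -> R.
Hypothesis bf : bounded_measurable f.

Lemma bounded_measurable_pair1 x : bounded_measurable (fun y => f (x, y)).
Proof. exact: (bounded_measurable_comp bf). Qed.

Lemma bounded_measurable_pair2 y : bounded_measurable (fun x => f (x, y)).
Proof. exact: (bounded_measurable_comp bf). Qed.

Let if12 : (P1 \x P2)%E.-integrable setT (EFin \o f).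
Proof. exact: (bounded_measurable_integrable (P1 \x P2)%E). Qed.

Lemma bounded_measurable_Rintegral1 :
  bounded_measurable (fun x => \int[P2]_y f (x, y)).
Proof.
split.
  apply/measurable_EFinP; have := measurable_fubini_F if12.
  congr measurable_fun; apply/funext => x /=.
  by rewrite EFin_Rintegral_bounded//; exact: bounded_measurable_pair1.
have [_ [M fM]] := bf; exists M => x.
by apply: Rintegral_probability_le => //; exact: bounded_measurable_pair1.
Qed.

Lemma bounded_measurable_Rintegral2 :
  bounded_measurable (fun y => \int[P1]_x f (x, y)).
Proof.
split.
  apply/measurable_EFinP; have := measurable_fubini_G if12.
  congr measurable_fun; apply/funext => x /=.
  by rewrite EFin_Rintegral_bounded//; exact: bounded_measurable_pair2.
have [_ [M fM]] := bf; exists M => x.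
by apply: Rintegral_probability_le => //; exact: bounded_measurable_pair2.
Qed.

Lemma bounded_Fubini1 :
  \int[(P1 \x P2)%E]_z f z = \int[P1]_x \int[P2]_y f (x, y).
Proof.
apply/EFin_inj; rewrite (EFin_Rintegral_bounded (P1 \x P2)%E)//.
rewrite EFin_Rintegral_bounded; last exact: bounded_measurable_Rintegral1.
rewrite -(integral12_prod_meas1 if12); apply: eq_integral => x _.
by rewrite EFin_Rintegral_bounded//; exact: bounded_measurable_pair1.
Qed.

Lemma bounded_Fubini2 :
  \int[(P1 \x P2)%E]_z f z = \int[P2]_y \int[P1]_x f (x, y).
Proof.
apply/EFin_inj; rewrite (EFin_Rintegral_bounded (P1 \x P2)%E)//.
rewrite EFin_Rintegral_bounded; last exact: bounded_measurable_Rintegral2.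
rewrite -(integral21_prod_meas1 if12); apply: eq_integral => x _.
by rewrite EFin_Rintegral_bounded//; exact: bounded_measurable_pair2.
Qed.

Lemma bounded_Fubini :
  \int[P1]_x \int[P2]_y f (x, y) = \int[P2]_y \int[P1]_x f (x, y).
Proof. by rewrite -bounded_Fubini1 bounded_Fubini2. Qed.

End bounded_fubini.

(** * Lebesgue measure and periodic functions *)

Definition image_measure {R : realType} d1 d2 (T1 : measurableType d1)
    (T2 : measurableType d2) (m : {measure set T1 -> \bar R}) (f : T1 -> T2)
    (mf : measurable_fun setT f) : {measure set T2 -> \bar R} :=
  measure_function_pushforward__canonical__measure_function_Measure m mf.

Section lebesgue_affine.
Context {R : realType}.
Local Notation mu := (@lebesgue_measure R).

(** Lebesgue measure is determined by the lengths of half-open intervals, and the preimage of such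
    an interval is a half-open interval of the same length. *)
Lemma lebesgue_measure_shift (h : R) (A : set R) : measurable A ->
  pushforward mu (fun x : measurableTypeR R => x + h : measurableTypeR R) A
  = mu A.
Proof.
move=> mA; have mf : measurable_fun setT
    (fun x : measurableTypeR R => x + h : measurableTypeR R).
  exact: measurable_funD.
apply/esym/lebesgue_measure_unique => //= _ [[a b]] _ <-.
rewrite /pushforward/=.
rewrite (_ : _ @^-1` _ = `](a - h), (b - h)]%classic); last first.
  by apply/seteqP; split => x /=; rewrite !in_itv/= ltrBlDr lerBrDr.
by rewrite !lebesgue_measure_itv/= !lte_fin ltrD2r -!EFinB; case: ifP => // _;
  congr EFin; ring.
Qed.

(** The same uniqueness argument, applied to the image measure multiplied by [s] to restore the
    length of intervals. *)
Lemma lebesgue_measure_scale (s : R) (A : set R) : 0 < s -> measurable A ->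
  pushforward mu (fun x : measurableTypeR R => s * x : measurableTypeR R) A
  = (s^-1%:E * mu A)%E.
Proof.
move=> s0 mA; have mf : measurable_fun setT
    (fun x : measurableTypeR R => s * x : measurableTypeR R).
  exact: measurable_funM.
have si : 0 <= s by exact: ltW.
pose m := mscale (NngNum si) (image_measure mu mf).
suff -> : mu A = m A.
  by rewrite /m /mscale/= /pushforward muleA -EFinM mulVf ?gt_eqF// mul1e.
apply: lebesgue_measure_unique => //= _ [[a b]] _ <-.
rewrite /m /mscale /image_measure /= /pushforward/=.
rewrite (_ : _ @^-1` _ = `](a / s), (b / s)]%classic); last first.
  by apply/seteqP; split => x /=; rewrite !in_itv/= ltr_pdivrMr// ler_pdivlMr// (mulrC x).
rewrite !lebesgue_measure_itv/= !lte_fin ltr_pM2r ?invr_gt0//; case: ifP => _.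
  by rewrite -!EFinB -EFinM; congr EFin; field; rewrite gt_eqF.
by rewrite mule0.
Qed.

Lemma ge0_integral_shift (h : R) (D : set R) (f : R -> \bar R) :
  measurable D -> measurable_fun setT f -> (forall x, (0 <= f x)%E) ->
  (\int[mu]_(x in [set x : R | D (x + h)%R]) f (x + h)%R = \int[mu]_(x in D) f x)%E.
Proof.
move=> mD mf f0.
have mh : measurable_fun setT
    (fun x : measurableTypeR R => x + h : measurableTypeR R).
  exact: measurable_funD.
rewrite -(@ge0_integral_pushforward _ _ _ _ _ _ mh mu D f) //; last first.
  exact: measurable_funTS.
by apply: (eq_measure_integral mu) => A mA _; exact: lebesgue_measure_shift.
Qed.

End lebesgue_affine.

Section periodic.
Context {R : realType}.

Lemma periodic_int (f : R -> R) (z : int) x :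
  (forall x, f (x + 1) = f x) -> f (x + z%:~R) = f x.
Proof.
move=> fp; have fn n y : f (y + n%:R) = f y.
  elim: n y => [|n IHn] y; first by rewrite addr0.
  by rewrite -natr1 addrA fp IHn.
case: z => n; first exact: fn.
by rewrite NegzE mulrNz -[in RHS](subrK n.+1%:R x) fn.
Qed.

Lemma periodic_frac (f : R -> R) (h : R) :
  (forall x, f (x + 1) = f x) ->
  exists2 r, 0 <= r < 1 & forall x, f (x + h) = f (x + r).
Proof.
move=> fp; exists (h - (Num.floor h)%:~R).
  have /andP[h0 h1] := floor_itv h.
  by rewrite subr_ge0 h0 ltrBlDl -intrD1.
move=> x.
by rewrite -[in RHS](periodic_int (Num.floor h) (x + _) fp) -addrA subrK.
Qed.

End periodic.

(** * Translation invariance of the uniform law on periodic functions *)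

Section uniform01.
Context {R : realType}.
Local Notation mu := (@lebesgue_measure R).

Definition uniform01 : probability (measurableTypeR R) R :=
  uniform_prob (@ltr01 R).

(** Once the shift is reduced to [r] in [[0, 1[], the integral runs over [[r, 1 + r[]; cutting at
    [1] and moving the overhang [[1, 1 + r[] back by one period recovers [[0, 1[]. *)
Let ge0_uniform01_shift (h : R) (f : R -> R) : measurable_fun setT f ->
  (forall x, 0 <= f x) -> (forall x, f (x + 1) = f x) ->
  (\int[uniform01]_x (f (x + h))%:E = \int[uniform01]_x (f x)%:E)%E.
Proof.
move=> mf f0 fp; have [r /andP[r0 r1] fr] := periodic_frac h fp.
under eq_integral do rewrite fr.
have mEf : measurable_fun setT (EFin \o f) by exact/measurable_EFinP.
have mfr : measurable_fun setT (fun x : R => (f (x + r))%:E).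
  apply: (measurableT_comp (f := EFin \o f) mEf (g := fun x : R => x + r)).
  exact: measurable_funD.
have Ef0 x : (0 <= (f x)%:E)%E by rewrite lee_fin.
rewrite !integral_uniform//; congr (_ * _)%E.
(* Half-open intervals are used so that the pieces cut at [r] and [1] are disjoint. *)
rewrite -!integral_itv_bndo_bndc; last 2 first.
- exact: measurable_funTS.
- exact: measurable_funTS.
have E : [set` `[0, 1[%R] = [set x : R | `[r, 1 + r[%classic (x + r)].
  by apply/seteqP; split => x /=; rewrite !in_itv/= -lerBlDr subrr ltrD2r.
rewrite [in LHS]E (ge0_integral_shift r _ mEf)//.
have integral_cat a b c : a <= b -> b <= c ->
    (\int[mu]_(x in `[a, c[) (f x)%:E =
     \int[mu]_(x in `[a, b[) (f x)%:E + \int[mu]_(x in `[b, c[) (f x)%:E)%E.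
  move=> ab bc; rewrite -ge0_integral_setU//=.
  - by rewrite -itv_bndbnd_setU.
  - exact: measurable_funTS.
  - apply/disj_setPS => y [/=]; rewrite 2!in_itv/= => /andP[_ yb] /andP[].
    by rewrite leNgt yb.
rewrite (integral_cat r 1 (1 + r)); [|exact: ltW|by rewrite lerDl].
rewrite (integral_cat 0 r 1) //; last exact: ltW.
rewrite addeC; congr (_ + _)%E.
rewrite -(ge0_integral_shift 1 _ mEf)//=.
rewrite (_ : mkset _ = `[0, r[%classic).
  by apply: eq_integral => x _; rewrite fp.
by apply/seteqP; split => x /=; rewrite !in_itv/= -lerBlDr subrr (addrC 1) ltrD2r.
Qed.

Lemma uniform01_shift (h : R) (f : R -> R) : bounded_measurable f ->
  (forall x, f (x + 1) = f x) ->
  \int[uniform01]_x f (x + h) = \int[uniform01]_x f x.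
Proof.
move=> bf fp; have [mf [M fM]] := bf.
have bfh : bounded_measurable (fun x : R => f (x + h)).
  by apply: bounded_measurable_comp bf _; exact: measurable_funD.
(* Adding the bound [M] makes the function nonnegative; the constant cancels at the end. *)
have : \int[uniform01]_x (f (x + h) + M) = \int[uniform01]_x (f x + M).
  congr fine; apply: (ge0_uniform01_shift h (f := fun x => f x + M)).
  - exact: measurable_funD.
  - by move=> x; have := fM x; rewrite ler_norml lerNl => /andP[]; lra.
  - by move=> x; rewrite fp.
have bM := bounded_measurable_cst (measurableTypeR R) M.
rewrite !RintegralD//; try exact: bounded_measurable_integrable.
exact: addIr.
Qed.

End uniform01.

(** * Gaussian noise *)

Section density.
Local Open Scope ereal_scope.
Context {R : realType} d (T : measurableType d).
Variables (mu m : {measure set T -> \bar R}) (g : T -> R).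
Hypotheses (mg : measurable_fun setT g) (g0 : forall x, (0 <= g x)%R).
Hypothesis mE : forall A, measurable A -> m A = \int[mu]_(x in A) (g x)%:E.

Import HBNNSimple.

Let integral_density_nnsfun (h : {nnsfun T >-> R}) :
  \int[m]_x (h x)%:E = \int[mu]_x ((h x)%:E * (g x)%:E).
Proof.
rewrite integralT_nnsfun sintegralE.
under [RHS]eq_integral.
  move=> x _; rewrite fimfunE -fsumEFin// ge0_mule_fsuml; last first.
    by move=> r; rewrite EFinM nnfun_muleindic_ge0.
  over.
have mh r : measurable_fun setT (fun x => (r * \1_(h @^-1` [set r]) x)%:E).
  exact/measurable_EFinP/measurable_funM.
rewrite ge0_integral_fsum//; last 2 first.
- by move=> r; apply: emeasurable_funM => //; exact/measurable_EFinP.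
- by move=> r x _; rewrite mule_ge0 ?(lee_fin _ (g x)) ?g0// EFinM nnfun_muleindic_ge0.
(* A negative [r] is not a value of the nonnegative function [h], so its level set is empty and both
   terms vanish. *)
apply: eq_fsbigr => r _; have [r0|r0] := leP 0%R r; last first.
  rewrite (_ : h @^-1` [set r] = set0) ?measure0 ?mule0; last first.
    by apply/seteqP; split => // x /= hx; move: r0; rewrite -hx ltNge fun_ge0.
  by rewrite integral0_eq// => x _; rewrite indic0 mulr0 mul0e.
rewrite mE// integral_mkcond -ge0_integralZl//=.
- apply: eq_integral => x _; rewrite patchE indicE EFinM -muleA.
  by case: ifPn => xr; rewrite ?mul1e ?mul0e ?mule0.
- apply/(measurable_restrictT _ _).1 => //; apply/measurable_EFinP.
  exact: measurable_funTS.
- by move=> x _; rewrite patchE; case: ifPn; rewrite ?lee_fin.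
Qed.

(** Simple functions follow from sets by linearity; monotone convergence along simple approximations
    gives the rest. *)
Lemma ge0_integral_density (f : T -> \bar R) : measurable_fun setT f ->
  (forall x, 0 <= f x) -> \int[m]_x f x = \int[mu]_x (f x * (g x)%:E).
Proof.
move=> mf f0; pose f_ := nnsfun_approx measurableT mf.
have mEg : measurable_fun setT (fun x => (g x)%:E) by exact/measurable_EFinP.
have cf x : (f_ n x)%:E @[n --> \oo] --> f x.
  by apply: cvg_nnsfun_approx.
transitivity (limn (fun n => \int[m]_x (f_ n x)%:E)).
  rewrite -monotone_convergence//=.
  - by apply: eq_integral => x _; apply/esym/cvg_lim.
  - by move=> n; exact/measurable_EFinP.
  - by move=> n x _; rewrite lee_fin.
  - by move=> x _ a b ab; rewrite lee_fin; exact/lefP/nd_nnsfun_approx.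
rewrite (_ : (fun n => _) =
    fun n => \int[mu]_x ((f_ n x)%:E * (g x)%:E)); last first.
  by apply/funext => n; exact: integral_density_nnsfun.
rewrite -monotone_convergence//=.
- apply: eq_integral => x _; apply/cvg_lim => //; apply: cvgeMr => //.
- by move=> n; apply: emeasurable_funM => //; exact/measurable_EFinP.
- by move=> n x _; rewrite mule_ge0 ?lee_fin ?g0.
- move=> x _ a b ab; rewrite lee_wpmul2r ?lee_fin ?g0//.
  exact/lefP/nd_nnsfun_approx.
Qed.

End density.

Section std_normal.
Context {R : realType}.
Local Notation mu := (@lebesgue_measure R).

Definition std_normal : probability (measurableTypeR R) R := normal_prob 0 1.

Lemma std_normal_sqr_lty : (\int[std_normal]_x (x ^+ 2)%:E < +oo)%E.
Proof.
rewrite (ge0_integral_density (mu := mu) (g := normal_pdf 0 1))//; last 4 first.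
- exact: measurable_normal_pdf.
- exact: normal_pdf_ge0.
- exact/measurable_EFinP/measurable_funX.
- by move=> x; rewrite lee_fin sqr_ge0.
(* Half of the Gaussian exponent is spent on [x ^+ 2]: [x ^+ 2 * expR (- (x ^+ 2 / 4))] is at most 4
   because [1 + y <= expR y]. The other half is, up to its peak, the density of variance 2. *)
pose C : R := 4 * normal_peak 1 / normal_peak (Num.sqrt 2).
have s2 : Num.sqrt 2 != 0 :> R by rewrite gt_eqF// sqrtr_gt0.
have p1 := normal_peak_gt0 (@oner_neq0 R).
have p2 := normal_peak_gt0 s2.
apply: (@le_lt_trans _ _ (\int[mu]_x (C%:E * (normal_pdf 0 (Num.sqrt 2) x)%:E))%E).
  apply: ge0_le_integral => //.
  - by move=> x _; rewrite mule_ge0 ?lee_fin ?sqr_ge0 ?normal_pdf_ge0.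
  - apply: emeasurable_funM; apply/measurable_EFinP; first exact: measurable_funX.
    exact: measurable_normal_pdf.
  - apply: emeasurable_funM => //; apply/measurable_EFinP.
    exact: measurable_normal_pdf.
  move=> x _; rewrite -!EFinM lee_fin !normal_pdfE// /= /normal_fun.
  rewrite subr0 sqr_sqrtr// expr1n.
  have -> : - x ^+ 2 / (1 *+ 2) = - (x ^+ 2 / 4) + - x ^+ 2 / (2 *+ 2) by field.
  rewrite expRD /C.
  set e := expR (- x ^+ 2 / (2 *+ 2)).
  rewrite [leRHS](_ : _ = normal_peak 1 * e * 4); last by field; rewrite gt_eqF.
  rewrite [leLHS](_ : _ = normal_peak 1 * e * (x ^+ 2 * expR (- (x ^+ 2 / 4)))); last by ring.
  rewrite ler_pM2l ?mulr_gt0 ?expR_gt0// expRN ler_pdivrMr ?expR_gt0//.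
  have := expR_ge1Dx (x ^+ 2 / 4); lra.
rewrite integralZl//; last exact: integrable_normal_pdf.
by rewrite integral_normal_pdf mule1 ltry.
Qed.

Lemma std_normal_integrable_sqr :
  std_normal.-integrable setT (EFin \o (fun x : measurableTypeR R => x ^+ 2)).
Proof.
apply/integrableP; split; first exact/measurable_EFinP/measurable_funX.
under eq_integral do rewrite /= ger0_norm ?sqr_ge0//.
exact: std_normal_sqr_lty.
Qed.

Lemma std_normal_integrable_id :
  std_normal.-integrable setT (EFin \o (fun x : measurableTypeR R => x)).
Proof.
apply: (@le_integrable _ _ _ std_normal setT _ _
  (fun x : measurableTypeR R => (1 + x ^+ 2)%:E)) => //.
- exact/measurable_EFinP.
- move=> x _ /=; rewrite lee_fin [leRHS]ger0_norm ?addr_ge0 ?sqr_ge0//.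
  rewrite -(real_normK (num_real x)); have := sqr_ge0 (`|x| - 1).
  by have := normr_ge0 x; nra.
- have i1 : std_normal.-integrable setT (EFin \o (fun=> 1 : R)).
    apply: (bounded_measurable_integrable std_normal).
    exact: bounded_measurable_cst.
  exact: (integrableD measurableT i1 std_normal_integrable_sqr).
Qed.

Lemma std_normal_opp (A : set R) : measurable A ->
  std_normal ((-%R : R -> R) @^-1` A) = std_normal A.
Proof.
move=> mA; rewrite /std_normal/= /normal_prob.
transitivity (\int[mu]_(x in [set x : R | A (- x)%R]) (normal_pdf 0 1 (- x)%R)%:E)%E.
  apply: eq_integral => x _; rewrite !normal_pdfE//.
  by rewrite /= /normal_fun !subr0 sqrrN.
have mN : measurable_fun setT (-%R : measurableTypeR R -> measurableTypeR R).
  exact: measurable_funN.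
rewrite -(@ge0_integral_pushforward _ _ _ _ _ _ mN mu A (EFin \o normal_pdf 0 1))//.
- by apply: (eq_measure_integral mu) => B mB _; exact: lebesgue_measureN.
- by apply: measurable_funTS; apply/measurable_EFinP; exact: measurable_normal_pdf.
- by move=> x _; rewrite lee_fin normal_pdf_ge0.
Qed.

(** By symmetry of the law the mean equals its own opposite. *)
Lemma std_normal_mean : \int[std_normal]_x x = 0.
Proof.
have mN : measurable_fun setT (-%R : measurableTypeR R -> measurableTypeR R).
  exact: measurable_funN.
suff : \int[std_normal]_x x = - \int[std_normal]_x x by lra.
rewrite -[RHS]mulN1r -RintegralZl//; last exact: std_normal_integrable_id.
congr fine.
transitivity (\int[image_measure std_normal mN]_x x%:E)%E.
  by apply: eq_measure_integral => A mA _; apply/esym; exact: std_normal_opp.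
rewrite integral_pushforward//.
- by apply: eq_integral => x _ /=; rewrite mulN1r.
- exact: (integrableN std_normal_integrable_id).
Qed.

End std_normal.

Section law.
Context {R : realType} d1 d2 (T1 : measurableType d1) (T2 : measurableType d2).
Variables (P : probability T1 R) (f : T1 -> T2) (mf : measurable_fun setT f).

(** The image measure, packaged as a probability from a function and its measurability proof so that
    it can be a factor of a product law. *)
Definition law : probability T2 R :=
  distribution P (HB.pack f (isMeasurableFun.Build _ _ _ _ f mf)).

Lemma ge0_integral_law (h : T2 -> \bar R) : measurable_fun setT h ->
  (forall x, (0 <= h x)%E) -> (\int[law]_x h x = \int[P]_x h (f x))%E.
Proof.
move=> mh h0; rewrite -[LHS]/(integral (pushforward P f) _ _).
by rewrite ge0_integral_pushforward.
Qed.

Lemma integrable_law (h : T2 -> \bar R) : measurable_fun setT h ->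
  P.-integrable setT (h \o f) -> law.-integrable setT h.
Proof. by move=> mh ih; exact: (integrable_pushforward mf mh). Qed.

Lemma integral_law (h : T2 -> \bar R) : measurable_fun setT h ->
  P.-integrable setT (h \o f) -> (\int[law]_x h x = \int[P]_x h (f x))%E.
Proof.
by move=> mh ih; rewrite -[LHS]/(integral (pushforward P f) _ _) integral_pushforward.
Qed.

End law.

Section noise.
Context {R : realType}.
Local Notation mu := (@lebesgue_measure R).

(* The Gaussian density of [s * x] is bounded below on [0, 1] by its value at 1. *)
Lemma std_normal_ge_uniform (s : R) : 0 < s ->
  exists2 c, 0 < c & forall f : R -> \bar R, measurable_fun setT f ->
    (forall x, (0 <= f x)%E) ->
    (c%:E * \int[@uniform01 R]_x f x <= \int[@std_normal R]_x f (s * x)%R)%E.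
Proof.
move=> s0; set p : R := normal_pdf 0 1 s^-1.
have p0 : 0 < p.
  by rewrite /p normal_pdfE//= mulr_gt0 ?normal_peak_gt0 ?expR_gt0.
have c0 : 0 < p / s by rewrite divr_gt0.
have ms : measurable_fun setT
    (fun x : measurableTypeR R => s * x : measurableTypeR R).
  exact: measurable_funM.
exists (p / s) => // f mf f0.
rewrite -[leRHS](ge0_integral_law std_normal ms)//.
rewrite -[leLHS](ge0_integral_mscale uniform01 measurableT (NngNum (ltW c0)))//.
apply: ge0_le_measure_integral => // A mA.
rewrite -[leRHS]/(normal_prob 0 1 [set x : R | A (s * x)]).
rewrite -[leLHS]/((p / s)%:E * uniform_prob (@ltr01 R) A)%E.
rewrite /uniform_prob /normal_prob.
have mA01 : measurable (A `&` `[0, 1]%classic) by exact: measurableI.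
have mpre B : measurable B -> measurable [set x : R | B (s * x)].
  by move=> mB; have := ms measurableT B mB; rewrite setTI.
rewrite integral_uniform_pdf (eq_integral (fun=> 1%E)); last first.
  move=> x; rewrite inE/= in_itv/= /uniform_pdf => -[_ ->].
  by rewrite subr0 invr1.
(* The factor [s^-1] of the constant is absorbed by the change of variables: what remains is the
   integral of the constant [p] over the preimage of [A] within [[0, 1]], to be compared with the
   density pointwise. *)
rewrite integral_cst// mul1e EFinM -muleA -lebesgue_measure_scale//.
rewrite /pushforward -[leLHS](integral_cst mu); last exact: mpre.
have sub : (\int[mu]_(x in [set x : R | (A `&` `[0%R, 1%R]%classic) (s * x)%R])
    (normal_pdf 0 1 x)%:E <=
    \int[mu]_(x in [set x | A (s * x)%R]) (normal_pdf 0 1 x)%:E)%E.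
  apply: ge0_subset_integral => //.
  - exact: mpre.
  - exact: mpre.
  - apply/measurable_EFinP; apply: measurable_funTS.
    exact: measurable_normal_pdf.
  - by move=> x _; rewrite lee_fin normal_pdf_ge0.
  - by move=> x [].
apply: le_trans sub.
apply: ge0_le_integral => //.
- exact: mpre.
- by move=> x _; rewrite lee_fin ltW.
- apply/measurable_EFinP; apply: measurable_funTS.
  exact: measurable_normal_pdf.
move=> x [_]; rewrite /= in_itv/= => /andP[sx0 sx1].
rewrite lee_fin /p !normal_pdfE//= ler_pM2l ?normal_peak_gt0//.
rewrite /normal_fun ler_expR !subr0 !mulNr lerN2 ler_pM2r ?invr_gt0 ?expr1n//.
have x0 : 0 <= x by rewrite -(pmulr_rge0 _ s0).
have xs : x <= s^-1 by rewrite -[leRHS]mul1r ler_pdivlMr// mulrC.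
by rewrite lerXn2r// nnegrE invr_ge0 ltW.
Qed.

(* [measurableTypeR R] rather than [R]: Lebesgue measure and the distributions
   live on this instance, whose display differs from the default one of [R]. *)
Definition plane := (measurableTypeR R * measurableTypeR R)%type.

Definition uniform_square : probability plane R :=
  (@uniform01 R \x @uniform01 R)%E.

Section noise_law.
Variable s : R.

Lemma measurable_scale_pair :
  measurable_fun setT (fun z : plane => (s * z.1, s * z.2) : plane).
Proof. by apply: measurable_fun_pair; exact: measurable_funM. Qed.

(** With [s] equal to [sigma] times the square root of the time step, this is the law of the
    Gaussian increment of one step of the scheme. *)
Definition noise : probability plane R :=
  law (std_normal \x std_normal)%E measurable_scale_pair.

(** Tonelli reduces to one coordinate, since the other integrates to 1. *)
Lemma noise_integrable1 (f : R -> R) : measurable_fun setT f ->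
  std_normal.-integrable setT (fun x => (f (s * x))%:E) ->
  noise.-integrable setT (fun z => (f z.1)%:E) /\
  \int[noise]_z f z.1 = \int[std_normal]_x f (s * x).
Proof.
move=> mf /[dup] fi /integrableP[mfs fsoo].
have mf1 : measurable_fun setT (fun z : plane => (f z.1)%:E).
  by apply/measurable_EFinP; apply: measurableT_comp mf _.
have mfs1 : measurable_fun setT (fun z : plane => (f (s * z.1))%:E).
  exact: (measurableT_comp mfs measurable_fst).
have ifs : (std_normal \x std_normal)%E.-integrable setT
    (fun z : plane => (f (s * z.1))%:E).
  apply/(integrable12ltyP _ _ mfs1).
  apply: le_lt_trans fsoo; rewrite le_eqVlt; apply/orP; left; apply/eqP/eq_integral => x _ /=.
  by rewrite integral_cst// [X in (_ * X)%E](@probability_setT _ _ _ std_normal) mule1.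
split; first exact: integrable_law.
rewrite /Rintegral; congr fine; rewrite integral_law//=.
rewrite -(integral12_prod_meas1 ifs); apply: eq_integral => x _.
by rewrite /fubini_F/= integral_cst// [X in (_ * X)%E](@probability_setT _ _ _ std_normal) mule1.
Qed.

Lemma noise_integrable2 (f : R -> R) : measurable_fun setT f ->
  std_normal.-integrable setT (fun x => (f (s * x))%:E) ->
  noise.-integrable setT (fun z => (f z.2)%:E) /\
  \int[noise]_z f z.2 = \int[std_normal]_x f (s * x).
Proof.
move=> mf /[dup] fi /integrableP[mfs fsoo].
have mf1 : measurable_fun setT (fun z : plane => (f z.2)%:E).
  by apply/measurable_EFinP; apply: measurableT_comp mf _.
have mfs1 : measurable_fun setT (fun z : plane => (f (s * z.2))%:E).
  exact: (measurableT_comp mfs measurable_snd).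
have ifs : (std_normal \x std_normal)%E.-integrable setT
    (fun z : plane => (f (s * z.2))%:E).
  apply/(integrable21ltyP _ _ mfs1).
  apply: le_lt_trans fsoo; rewrite le_eqVlt; apply/orP; left; apply/eqP/eq_integral => x _ /=.
  by rewrite integral_cst// [X in (_ * X)%E](@probability_setT _ _ _ std_normal) mule1.
split; first exact: integrable_law.
rewrite /Rintegral; congr fine; rewrite integral_law//=.
rewrite -(integral21_prod_meas1 ifs); apply: eq_integral => x _.
by rewrite /fubini_G/= integral_cst// [X in (_ * X)%E](@probability_setT _ _ _ std_normal) mule1.
Qed.

Let scaled_id : std_normal.-integrable setT (fun x : R => (s * x)%:E).
Proof. exact: (integrableZl measurableT s std_normal_integrable_id). Qed.

Let scaled_sqr : std_normal.-integrable setT (fun x : R => ((s * x) ^+ 2)%:E).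
Proof.
under eq_fun do rewrite exprMn EFinM.
exact: (integrableZl measurableT (s ^+ 2) std_normal_integrable_sqr).
Qed.

Let scaled_mean : \int[std_normal]_x (s * x) = 0.
Proof.
rewrite RintegralZl ?std_normal_mean ?mulr0//.
exact: std_normal_integrable_id.
Qed.

Let msqr : measurable_fun setT (fun x : R => x ^+ 2).
Proof. exact: measurable_funX. Qed.

Lemma noise_integrable_fst : noise.-integrable setT (fun z => z.1%:E).
Proof. exact: (noise_integrable1 (@measurable_id _ R setT) scaled_id).1. Qed.

Lemma noise_integrable_snd : noise.-integrable setT (fun z => z.2%:E).
Proof. exact: (noise_integrable2 (@measurable_id _ R setT) scaled_id).1. Qed.

Lemma noise_integrable_fst_sqr : noise.-integrable setT (fun z => (z.1 ^+ 2)%:E).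
Proof. exact: (noise_integrable1 msqr scaled_sqr).1. Qed.

Lemma noise_integrable_snd_sqr : noise.-integrable setT (fun z => (z.2 ^+ 2)%:E).
Proof. exact: (noise_integrable2 msqr scaled_sqr).1. Qed.

Lemma noise_mean_fst : \int[noise]_z z.1 = 0.
Proof. by rewrite (noise_integrable1 (@measurable_id _ R setT) scaled_id).2 scaled_mean. Qed.

Lemma noise_mean_snd : \int[noise]_z z.2 = 0.
Proof. by rewrite (noise_integrable2 (@measurable_id _ R setT) scaled_id).2 scaled_mean. Qed.

(** The one-dimensional minorization is used once per coordinate, so the constant is squared. *)
Lemma noise_ge_uniform : 0 < s ->
  exists2 c, 0 < c & forall f : plane -> R, bounded_measurable f ->
    (forall x, 0 <= f x) ->
    c * \int[uniform_square]_x f x <= \int[noise]_x f x.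
Proof.
move=> /std_normal_ge_uniform[c c0 cP].
have le f : bounded_measurable f -> (forall x : plane, 0 <= f x) ->
    c ^+ 2 * \int[uniform_square]_x f x <= \int[noise]_x f x.
  move=> bf f0; have [mf _] := bf.
  have mEf : measurable_fun setT (EFin \o f) by exact/measurable_EFinP.
  suff : ((c ^+ 2)%:E * \int[uniform_square]_x (f x)%:E <=
      \int[noise]_x (f x)%:E)%E.
    rewrite -(EFin_Rintegral_bounded noise bf).
    by rewrite -(EFin_Rintegral_bounded uniform_square bf) -EFinM lee_fin.
  rewrite ge0_integral_law//.
  rewrite (fubini_tonelli1 (fun z : plane => (f (s * z.1, s * z.2))%:E)); last 2 first.
  - exact: (measurableT_comp mEf measurable_scale_pair).
  - by move=> x; rewrite lee_fin.
  rewrite (fubini_tonelli1 (fun z : plane => (f z)%:E))//.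
  have mfy x : measurable_fun setT (fun y : R => (f (x, y))%:E).
    exact: (measurableT_comp mEf).
  have mF : measurable_fun setT
      (fun x : R => \int[@uniform01 R]_y (f (x, y))%:E)%E.
    apply: (measurable_fun_fubini_tonelli_F (fun z : plane => (f z)%:E)) => //.
  have F0 x : (0 <= \int[@uniform01 R]_y (f (x, y))%:E)%E.
    by apply: integral_ge0 => y _; rewrite lee_fin.
  have c0' : (0 <= c%:E)%E by rewrite lee_fin ltW.
  rewrite expr2 EFinM -muleA.
  (* The intermediate law is Gaussian in the first coordinate and still uniform in the second. *)
  apply: (@le_trans _ _ (c%:E * \int[@std_normal R]_x
      \int[@uniform01 R]_y (f ((s * x)%R, y))%:E)%E).
    by apply: lee_wpmul2l => //; exact: (cP _ mF F0).
  rewrite -ge0_integralZl//; last first.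
    exact: (measurableT_comp mF (measurable_funM _ _)).
  apply: ge0_le_integral; [exact: measurableT|..].
  - by move=> x _; exact: mule_ge0.
  - apply: emeasurable_funM => //.
    exact: (measurableT_comp mF (measurable_funM _ _)).
  - apply: (measurable_fun_fubini_tonelli_F
      (fun z : plane => (f (s * z.1, s * z.2))%:E)).
      exact: (measurableT_comp mEf measurable_scale_pair).
    by move=> x; rewrite lee_fin.
  - by move=> x _; apply: cP => // y; rewrite lee_fin.
by exists (c ^+ 2); [exact: exprn_gt0|exact: le].
Qed.

End noise_law.

(** * Shears preserve the uniform law on the unit square *)

Section uniform_square_invariance.
Variable f : plane -> R.
Hypothesis bf : bounded_measurable f.

(** With [y] fixed, the shear is a translation by [a y]; integrating over the sheared coordinate
    first makes [uniform01_shift] applicable. *)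
Lemma uniform_square_shear1 (a : R -> R) : measurable_fun setT a ->
  (forall x y, f (x + 1, y) = f (x, y)) ->
  \int[uniform_square]_x f (x.1 + a x.2, x.2) = \int[uniform_square]_x f x.
Proof.
move=> ma fp; rewrite /uniform_square bounded_Fubini2; last first.
  apply: (bounded_measurable_comp bf); apply: measurable_fun_pair => //.
  by apply: measurable_funD => //; exact: measurableT_comp ma _.
rewrite (bounded_Fubini2 _ _ bf); apply: eq_Rintegral => y _ /=.
apply: (uniform01_shift (a y) (f := fun x => f (x, y))) => //.
exact: bounded_measurable_pair2.
Qed.

Lemma uniform_square_shear2 (a : R -> R) : measurable_fun setT a ->
  (forall x y, f (x, y + 1) = f (x, y)) ->
  \int[uniform_square]_x f (x.1, x.2 + a x.1) = \int[uniform_square]_x f x.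
Proof.
move=> ma fp; rewrite /uniform_square bounded_Fubini1; last first.
  apply: (bounded_measurable_comp bf); apply: measurable_fun_pair => //.
  by apply: measurable_funD => //; exact: measurableT_comp ma _.
rewrite (bounded_Fubini1 _ _ bf); apply: eq_Rintegral => x _ /=.
apply: (uniform01_shift (a x) (f := fun y => f (x, y))) => //.
exact: bounded_measurable_pair1.
Qed.

End uniform_square_invariance.

Lemma uniform_square_fst (a : R -> R) : bounded_measurable a ->
  \int[uniform_square]_x a x.1 = \int[uniform01]_x a x.
Proof.
move=> ba; rewrite /uniform_square bounded_Fubini1; last exact: (bounded_measurable_comp ba).
by apply: eq_Rintegral => x _ /=; exact: Rintegral_probability_cst.
Qed.

Lemma uniform_square_snd (a : R -> R) : bounded_measurable a ->
  \int[uniform_square]_x a x.2 = \int[uniform01]_x a x.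
Proof.
move=> ba; rewrite /uniform_square bounded_Fubini2; last exact: (bounded_measurable_comp ba).
by apply: eq_Rintegral => x _ /=; exact: Rintegral_probability_cst.
Qed.

End noise.

(** * Independence of the past from the next innovation *)

Section rectangle_uniqueness.
Context {R : realType} d1 d2 (T1 : measurableType d1) (T2 : measurableType d2).

Lemma measure_rectangle_unique (m1 m2 : {measure set (T1 * T2) -> \bar R}) :
  (m1 setT < +oo)%E ->
  (forall A B, measurable A -> measurable B -> m1 (A `*` B) = m2 (A `*` B)) ->
  forall D, measurable D -> m1 D = m2 D.
Proof.
move=> m1oo m12.
pose C : set (set (T1 * T2)) :=
  [set C | exists A, measurable A /\ exists B, measurable B /\ C = A `*` B].
move=> D mD; apply: (measure_unique C (fun _ => setT)) => //.
- rewrite measurable_prod_measurableType //; congr (<<s _ >>).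
  rewrite predeqE; split => [[A mA [B mB <-]]|[A [mA [B [mB ->]]]]].
    by exists A; split => //; exists B.
  by exists A => //; exists B.
- move=> /= _ _ [X1 [mX1 [X2 [mX2 ->]]]] [Y1 [mY1 [Y2 [mY2 ->]]]].
  rewrite -setXI; exists (X1 `&` Y1); split; first exact: measurableI.
  by exists (X2 `&` Y2); split => //; exact: measurableI.
- move=> _; exists setT; split => //; exists setT; split => //.
  by rewrite setXTT.
- by rewrite bigcup_const.
- by move=> _ [A [mA [B [mB ->]]]]; exact: m12.
Qed.

End rectangle_uniqueness.

Section independence.
Context {R : realType} d (Omega : measurableType d) (P : probability Omega R).
Context (I : eqType) (xi : I -> Omega -> R).
Hypothesis mxi : forall j, measurable_fun setT (xi j).

(** Joint independence of [X] from the whole family indexed by [J], tested on finite lists as in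
    [mutually_independent]. The set [J] shrinks as innovations are absorbed into [X]. *)
Definition indep_from d' (T : measurableType d') (X : Omega -> T)
    (J : pred I) :=
  forall (B : set T) (s : seq I) (A : I -> set R), measurable B -> uniq s ->
    {subset s <= J} -> (forall j, measurable (A j)) ->
    (P (X @^-1` B `&` \bigcap_(j in [set` s]) (xi j @^-1` A j)) =
     P (X @^-1` B) * \prod_(j <- s) P (xi j @^-1` A j))%E.

Lemma indep_from_cst d' (T : measurableType d') (x : T) (J : pred I) :
  mutually_independent P xi -> indep_from (fun _ => x) J.
Proof.
move=> Pxi B s A mB us sJ mA; have [xB|xB] := pselect (B x).
  rewrite (_ : _ @^-1` B = setT); last by apply/seteqP; split.
  by rewrite setTI probability_setT mul1e; exact: Pxi.
rewrite (_ : _ @^-1` B = set0); last by apply/seteqP; split.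
by rewrite set0I measure0 mul0e.
Qed.

Lemma indep_from_comp d1 d2 (T1 : measurableType d1) (T2 : measurableType d2)
    (X : Omega -> T1) (g : T1 -> T2) (J : pred I) : measurable_fun setT g ->
  indep_from X J -> indep_from (fun w => g (X w)) J.
Proof.
move=> mg iX B s A mB us sJ mA; apply: (iX (g @^-1` B)) => //.
by rewrite -[_ @^-1` _]setTI; exact: mg.
Qed.

Lemma indep_from_sub d' (T : measurableType d') (X : Omega -> T)
    (J J' : pred I) : {subset J' <= J} -> indep_from X J -> indep_from X J'.
Proof. by move=> JJ iX B s A mB us sJ' mA; apply: iX => // j /sJ' /JJ. Qed.

Context d' (T : measurableType d') (X : Omega -> T) (J : pred I) (j : I).
Hypotheses (mX : measurable_fun setT X) (iX : indep_from X J) (Jj : J j).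

Let mpre (k : I) (A : set R) : measurable A -> measurable (xi k @^-1` A).
Proof. by move=> mA; rewrite -[_ @^-1` _]setTI; exact: mxi. Qed.

Let mXxi : measurable_fun setT
  (fun w => (X w, xi j w) : T * measurableTypeR R).
Proof.
have m : measurable_fun setT (xi j : Omega -> measurableTypeR R) by exact: mxi.
exact: measurable_fun_pair mX m.
Qed.

Let indep1 (B : set T) (D : set R) : measurable B -> measurable D ->
  (P (X @^-1` B `&` xi j @^-1` D) = P (X @^-1` B) * P (xi j @^-1` D))%E.
Proof.
move=> mB mD; have := iX (B := B) (s := [:: j]) (A := fun=> D) mB.
rewrite big_seq1 set_cons1 bigcap_set1; apply => // k.
by rewrite inE => /eqP ->.
Qed.

(** With the event [E] of the other innovations fixed, both sides are finite measures in [B]: the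
    law of the pair restricted to [E], and that law scaled by a product of probabilities. They agree
    on rectangles by independence along [j :: s]. *)
Lemma indep_from_pair : indep_from (fun w => (X w, xi j w)) (predD1 J j).
Proof.
move=> B s A mB us sJ mA; set E := \bigcap_(_ in _) _.
have mE : measurable E.
  apply: fin_bigcap_measurable => [|k _]; first exact: finite_seq.
  exact: mpre.
have pf : (\prod_(k <- s) P (xi k @^-1` A k))%E \is a fin_num.
  elim/big_ind : _ => // [x y|k _]; first exact: fin_numM.
  by apply: fin_num_measure; exact: mpre.
have pge0 : (0 <= \prod_(k <- s) P (xi k @^-1` A k))%E.
  by elim/big_ind : _ => // x y; exact: mule_ge0.
pose c := NngNum (fine_ge0 pge0).
pose m1 := image_measure (mrestr P mE) mXxi.
pose m2 := mscale c (image_measure P mXxi).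
have : m1 B = m2 B.
  apply: measure_rectangle_unique => // [|B1 D mB1 mD].
    apply: le_lt_trans (ltry 1).
    have le1 : (P (setT `&` E) <= 1)%E by apply: probability_le1; rewrite setTI.
    exact: le1.
  rewrite -[LHS]/(P (X @^-1` B1 `&` xi j @^-1` D `&` E)).
  rewrite -[RHS]/((fine (\prod_(k <- s) P (xi k @^-1` A k)))%:E *
    P (X @^-1` B1 `&` xi j @^-1` D))%E.
  rewrite fineK// indep1//.
  have js : j \notin s by apply/negP => /sJ; rewrite inE/= eqxx.
  (* The test sets are redefined at [j] only; [j] is not in [s], so the events indexed by [s] are
     unchanged. *)
  pose A' k := if k == j then D else A k.
  have A'E k : k \in s -> A' k = A k.
    by rewrite /A'; case: eqP => // -> js'; rewrite js' in js.
  have prodE : (\prod_(k <- s) P (xi k @^-1` A' k) =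
      \prod_(k <- s) P (xi k @^-1` A k))%E.
    by apply: eq_big_seq => k /A'E ->.
  have capE : \bigcap_(k in [set` s]) (xi k @^-1` A' k) = E.
    by apply: eq_bigcapr => k /A'E ->.
  have consE : [set` j :: s] = j |` [set` s].
    apply/seteqP; split => k /=; rewrite inE.
      by move=> /predU1P[->|ks]; [left|right].
    by case=> [->|ks]; apply/predU1P; [left|right].
  have := iX (B := B1) (s := j :: s) (A := A') mB1.
  rewrite consE bigcap_setU1 capE big_cons prodE (_ : A' j = D); last by rewrite /A' eqxx.
  rewrite -setIA muleA (muleC (\prod_(_ <- _) _)%E); apply.
  - by rewrite /= js.
  - by move=> k; rewrite inE => /predU1P[->//|/sJ]; rewrite inE => /andP[].
  - by move=> k; rewrite /A'; case: ifP.
rewrite -[X in X = _ -> _]/(P ((fun w => (X w, xi j w)) @^-1` B `&` E)) => ->.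
rewrite -[LHS]/((fine (\prod_(k <- s) P (xi k @^-1` A k)))%:E *
  P ((fun w => (X w, xi j w)) @^-1` B))%E.
by rewrite fineK// muleC.
Qed.

(** Plays the part of conditional expectation given [X]: the joint law of [X] and [xi j] is a
    product law, and Tonelli integrates out the innovation. *)
Lemma ge0_integral_indep (mu : probability (measurableTypeR R) R)
    (h : T * measurableTypeR R -> \bar R) :
  (forall A, measurable A -> P (xi j @^-1` A) = mu A) ->
  measurable_fun setT h -> (forall x, (0 <= h x)%E) ->
  (\int[P]_w h (X w, xi j w) = \int[P]_w \int[mu]_z h (X w, z))%E.
Proof.
move=> xij mh h0.
rewrite -(ge0_integral_law P mXxi)//.
transitivity (\int[(law P mX \x mu)%E]_x h x)%E.
  apply: (eq_measure_integral (law P mX \x mu)%E) => A mA _.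
  apply: (measure_rectangle_unique (m1 := law P mXxi) (m2 := (law P mX \x mu)%E)) => //.
    by apply: le_lt_trans (ltry 1); exact: probability_le1.
  move=> B D mB mD; rewrite /= product_measure1E//=.
  by rewrite -[LHS]/(P (X @^-1` B `&` xi j @^-1` D)) indep1// xij.
rewrite fubini_tonelli1// ge0_integral_law//.
- exact: measurable_fun_fubini_tonelli_F.
- by move=> x; exact: integral_ge0.
Qed.

End independence.

(** * Contraction on periodic mean-zero functions *)

Section centered_periodic.
Context {R : realType}.
Local Notation plane := (@plane R).
Implicit Types (L K M : R) (f g : plane -> R) (a b : R -> R).

(** The bound [L] is a parameter because the contraction is expressed as a change of [L]. *)
Definition centered_periodic (L : R) (f : plane -> R) :=
  [/\ measurable_fun setT f, (forall x, `|f x| <= L),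
      (forall x y, f (x + 1, y) = f (x, y)),
      (forall x y, f (x, y + 1) = f (x, y)) &
      \int[uniform_square]_x f x = 0].

Lemma centered_periodic_bounded L f :
  centered_periodic L f -> bounded_measurable f.
Proof. by move=> [mf fL _ _ _]; split => //; exists L. Qed.

Lemma centered_periodic0 L : 0 <= L -> centered_periodic L (fun=> 0).
Proof.
by move=> L0; split => //; [move=> x; rewrite normr0|exact: Rintegral_probability_cst].
Qed.

Lemma centered_periodicD L K f g : centered_periodic L f ->
  centered_periodic K g -> centered_periodic (L + K) (fun x => f x + g x).
Proof.
move=> hf hg; have [mf fL f1 f2 f0] := hf; have [mg gK g1 g2 g0] := hg.
split => [|x|x y|x y|].
- exact: measurable_funD.
- by rewrite (le_trans (ler_normD _ _))// lerD.
- by rewrite f1 g1.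
- by rewrite f2 g2.
- rewrite RintegralD// ?f0 ?g0 ?addr0//.
  + exact: (bounded_measurable_integrable _ (centered_periodic_bounded hf)).
  + exact: (bounded_measurable_integrable _ (centered_periodic_bounded hg)).
Qed.

Definition shear1 (a : R -> R) (x : plane) : plane := (x.1 + a x.2, x.2).
Definition shear2 (b : R -> R) (x : plane) : plane := (x.1, x.2 + b x.1).
(** The second shear reads the first coordinate already updated, exactly as [v2] is evaluated in the
    scheme; this staggering is what makes the step a composition of measure-preserving maps. *)
Definition flow (a b : R -> R) (x : plane) : plane := shear2 b (shear1 a x).

Lemma measurable_shear1 a : measurable_fun setT a ->
  measurable_fun setT (shear1 a).
Proof.
move=> ma; apply: measurable_fun_pair => //.
by apply: measurable_funD => //; exact: measurableT_comp ma _.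
Qed.

Lemma measurable_shear2 a : measurable_fun setT a ->
  measurable_fun setT (shear2 a).
Proof.
move=> ma; apply: measurable_fun_pair => //.
by apply: measurable_funD => //; exact: measurableT_comp ma _.
Qed.

Lemma measurable_flow a b : measurable_fun setT a -> measurable_fun setT b ->
  measurable_fun setT (flow a b).
Proof.
move=> ma mb.
exact: (measurableT_comp (measurable_shear2 mb) (measurable_shear1 ma)).
Qed.

Lemma centered_periodic_shear1 L f a : measurable_fun setT a ->
  (forall x, a (x + 1) = a x) -> centered_periodic L f ->
  centered_periodic L (fun x => f (shear1 a x)).
Proof.
move=> ma ap hf; have [mf fL f1 f2 f0] := hf; split => [|x|x y|x y|].
- exact: (measurableT_comp mf (measurable_shear1 ma)).
- exact: fL.
- by rewrite /shear1/= addrAC f1.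
- by rewrite /shear1/= ap f2.
- rewrite -[RHS]f0.
  exact: (uniform_square_shear1 (centered_periodic_bounded hf) ma f1).
Qed.

Lemma centered_periodic_shear2 L f a : measurable_fun setT a ->
  (forall x, a (x + 1) = a x) -> centered_periodic L f ->
  centered_periodic L (fun x => f (shear2 a x)).
Proof.
move=> ma ap hf; have [mf fL f1 f2 f0] := hf; split => [|x|x y|x y|].
- exact: (measurableT_comp mf (measurable_shear2 ma)).
- exact: fL.
- by rewrite /shear2/= ap f1.
- by rewrite /shear2/= addrAC f2.
- rewrite -[RHS]f0.
  exact: (uniform_square_shear2 (centered_periodic_bounded hf) ma f2).
Qed.

Definition velocity (M : R) (a : R -> R) :=
  [/\ measurable_fun setT a, (forall x, `|a x| <= M),
      (forall x, a (x + 1) = a x) & \int[uniform01]_x a x = 0].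

Lemma velocity_bounded M a : velocity M a -> bounded_measurable a.
Proof. by move=> [ma aM _ _]; split => //; exists M. Qed.

Lemma centered_periodic_flow L f M a b : velocity M a -> velocity M b ->
  centered_periodic L f -> centered_periodic L (fun x => f (flow a b x)).
Proof.
move=> [ma _ ap _] [mb _ bp _] hf.
apply: (centered_periodic_shear1 (f := fun x => f (shear2 b x)) ma ap).
exact: centered_periodic_shear2.
Qed.

Lemma centered_periodic_drift1 M a b : velocity M a ->
  centered_periodic M (fun x => (flow a b x).1 - x.1).
Proof.
move=> ha; have [ma aM ap a0] := ha.
rewrite (_ : (fun _ => _) = fun x => a x.2); last first.
  by apply/funext => x; rewrite /= addrAC subrr add0r.
split => //; last by rewrite uniform_square_snd//; exact: velocity_bounded ha.
exact: measurableT_comp ma _.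
Qed.

(** The second displacement is [b] evaluated after the first shear; its mean vanishes because that
    shear preserves the uniform law. *)
Lemma centered_periodic_drift2 M a b : velocity M a -> velocity M b ->
  centered_periodic M (fun x => (flow a b x).2 - x.2).
Proof.
move=> [ma _ ap _] hb; have [mb bM bp b0] := hb.
rewrite (_ : (fun _ => _) = fun x => b (shear1 a x).1); last first.
  by apply/funext => x; rewrite /= addrAC subrr add0r.
apply: (centered_periodic_shear1 (f := fun x => b x.1) ma ap).
split => //; last by rewrite uniform_square_fst//; exact: velocity_bounded hb.
- exact: measurableT_comp mb _.
- by move=> x y; exact: bp.
Qed.

Definition translate (x z : plane) : plane := (x.1 + z.1, x.2 + z.2).

Lemma measurable_translate :
  measurable_fun setT (fun w : plane * plane => translate w.1 w.2).
Proof.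
by apply: measurable_fun_pair; apply: measurable_funD; exact: measurableT_comp.
Qed.

Section smoothing.
Variables (s c : R).
Hypothesis noise_ge : forall f : plane -> R, bounded_measurable f ->
  (forall x, 0 <= f x) ->
  c * \int[uniform_square]_x f x <= \int[noise s]_x f x.

Definition smoothing (f : plane -> R) (x : plane) :=
  \int[noise s]_z f (translate x z).

Let centered_periodic_translate L f z : centered_periodic L f ->
  centered_periodic L (fun x => f (translate x z)).
Proof.
move=> hf; apply: (centered_periodic_shear1 (a := fun=> z.1)
  (f := fun x => f (shear2 (fun=> z.2) x))) => //.
exact: centered_periodic_shear2.
Qed.

Let translateC x z : translate x z = translate z x.
Proof. by rewrite /translate addrC (addrC x.2). Qed.

(* Doeblin: [L + f] and [L - f] are nonnegative with mean [L], so the minorization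
   bounds their smoothings below by [c * L]. *)
Lemma centered_periodic_smoothing L f : centered_periodic L f ->
  centered_periodic ((1 - c) * L) (smoothing f).
Proof.
move=> hf; have [mf fL f1 f2 f0] := hf.
have bf := centered_periodic_bounded hf.
have bft : bounded_measurable
    (fun w : plane * plane => f (translate w.1 w.2)).
  exact: (bounded_measurable_comp bf measurable_translate).
split => [|x|x y|x y|].
- by have [] := bounded_measurable_Rintegral1 uniform_square (noise s) bft.
- have hx : centered_periodic L (fun z => f (translate x z)).
    under eq_fun do rewrite translateC.
    exact: centered_periodic_translate.
  have bx := centered_periodic_bounded hx.
  have ix (P : probability (plane) R) := bounded_measurable_integrable P bx.
  have bL := bounded_measurable_cst (plane) L.
  have iL (P : probability (plane) R) := bounded_measurable_integrable P bL.
  have [_ _ _ _ fx0] := hx.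
  have bN : bounded_measurable (fun z : plane => - 1 * f (translate x z)).
    split; last by exists L => z; rewrite mulN1r normrN.
    by apply: measurable_funM => //; case: bx.
  have iN (P : probability plane R) := bounded_measurable_integrable P bN.
  have ED (P : probability plane R) :
      \int[P]_z (L + f (translate x z)) = L + \int[P]_z f (translate x z).
    by rewrite (RintegralD measurableT (iL P) (ix P)) Rintegral_probability_cst.
  have EN (P : probability plane R) :
      \int[P]_z (L + - 1 * f (translate x z)) = L - \int[P]_z f (translate x z).
    rewrite (RintegralD measurableT (iL P) (iN P)) Rintegral_probability_cst.
    by rewrite (RintegralZl (- 1) measurableT (ix P)) mulN1r.
  have := noise_ge (bounded_measurableD bL bx).
  have := noise_ge (bounded_measurableD bL bN).
  rewrite !ED !EN fx0 -/(smoothing f x).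
  have fb z := fL (translate x z).
  move=> h1 h2; rewrite ler_norml; apply/andP; split.
    have : c * (L + 0) <= L + smoothing f x.
      by apply: h2 => z; have := fb z; rewrite ler_norml => /andP[]; lra.
    by lra.
  have : c * (L - 0) <= L - smoothing f x.
    by apply: h1 => z; have := fb z; rewrite ler_norml => /andP[]; lra.
  by lra.
- by apply: eq_Rintegral => z _; rewrite /translate/= addrAC f1.
- by apply: eq_Rintegral => z _; rewrite /translate/= addrAC f2.
(* Averaging over the square first, each translate of [f] already has mean zero. *)
- rewrite (bounded_Fubini uniform_square (noise s) bft).
  rewrite -[RHS](Rintegral_probability_cst (noise s) 0).
  apply: eq_Rintegral => z _.
  by have [] := centered_periodic_translate z hf.
Qed.

End smoothing.

(** * One-step second moment estimate *)

Section second_moment.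
Variables (s : R) (zeta : plane -> R).
Hypothesis mzeta : measurable_fun setT zeta.
Hypothesis izeta : (noise s).-integrable setT (fun z => (zeta z)%:E).
Hypothesis izeta2 : (noise s).-integrable setT (fun z => (zeta z ^+ 2)%:E).
Hypothesis zeta0 : \int[noise s]_z zeta z = 0.

(** Here [b] will be an unbounded position, so its square must keep coefficient 1. The product of
    [b] and [zeta] has mean zero, that of [b] and [g] completes the square, and that of [zeta] and
    [g], free of [b], can be estimated crudely. *)
Lemma second_moment_le (L b : R) (g : plane -> R) : bounded_measurable g ->
  (forall z, `|g z| <= L) ->
  (\int[noise s]_z ((b + zeta z + g z) ^+ 2)%:E <=
   ((b + \int[noise s]_z g z) ^+ 2
     + 2 * (\int[noise s]_z (zeta z ^+ 2) + L ^+ 2))%:E)%E.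
Proof.
move=> bg gL; have [mg _] := bg.
have ig := bounded_measurable_integrable (noise s) bg.
(* Pointwise majorant obtained from [2 * zeta z * g z <= zeta z ^+ 2 + g z ^+ 2] and
   [g z ^+ 2 <= L ^+ 2]. *)
set q := fun z => (b ^+ 2 + 2 * L ^+ 2) + 2 * b * g z + 2 * b * zeta z
  + 2 * zeta z ^+ 2.
have bK := bounded_measurable_cst (plane) (b ^+ 2 + 2 * L ^+ 2).
have iK := bounded_measurable_integrable (noise s) bK.
have i2g : (noise s).-integrable setT (fun z => (2 * b * g z)%:E).
  exact: (integrableZl measurableT (2 * b) ig).
have i2z : (noise s).-integrable setT (fun z => (2 * b * zeta z)%:E).
  exact: (integrableZl measurableT (2 * b) izeta).
have i2z2 : (noise s).-integrable setT (fun z => (2 * zeta z ^+ 2)%:E).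
  exact: (integrableZl measurableT 2 izeta2).
have i12 := integrableD measurableT iK i2g.
have i123 := integrableD measurableT i12 i2z.
have iq : (noise s).-integrable setT (EFin \o q).
  exact: (integrableD measurableT i123 i2z2).
have qE : \int[noise s]_z q z = b ^+ 2 + 2 * L ^+ 2
    + 2 * b * \int[noise s]_z g z + 2 * \int[noise s]_z (zeta z ^+ 2).
  rewrite /q RintegralD// RintegralD// RintegralD//.
  by rewrite Rintegral_probability_cst !RintegralZl// zeta0 mulr0 addr0.
apply: (@le_trans _ _ (\int[noise s]_z (q z)%:E)%E).
  apply: ge0_le_integral => //.
  - by move=> z _; rewrite lee_fin sqr_ge0.
  - apply/measurable_EFinP/measurable_funX/measurable_funD => //.
    exact: measurable_funD.
  - exact: (measurable_int _ iq).
  - move=> z _; rewrite lee_fin /q.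
    have gz : g z ^+ 2 <= L ^+ 2.
      by rewrite -(real_normK (num_real (g z))) lerXn2r ?nnegrE// (le_trans _ (gL z)).
    have := sqr_ge0 (zeta z - g z); nra.
rewrite -(fineK (integrable_fin_num measurableT iq)) lee_fin.
rewrite -/(Rintegral _ _ _) qE.
have := sqr_ge0 (\int[noise s]_z g z); nra.
Qed.

End second_moment.

End centered_periodic.

(** * The Markov chain *)

Section chain.
Context {R : realType} d (Omega : measurableType d) (P : probability Omega R).
Local Notation plane := (@plane R).
Variables (xi : bool * nat -> Omega -> R) (s M : R) (a b : nat -> R -> R).
Variable x0 : plane.
Hypothesis s0 : 0 < s.
Hypothesis mxi : forall j, measurable_fun setT (xi j).
Hypothesis xi_law : forall j A, measurable A -> P (xi j @^-1` A) = std_normal A.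
Hypothesis xi_indep : mutually_independent P xi.
Hypotheses (aM : forall n, velocity M (a n)) (bM : forall n, velocity M (b n)).

Fixpoint chain (n : nat) (w : Omega) : plane :=
  if n isn't m.+1 then x0 else
  translate (flow (a m) (b m) (chain m w)) (s * xi (true, m) w, s * xi (false, m) w).

Let future (n : nat) : pred (bool * nat) := [pred j | n <= j.2]%N.

Let noise_step (n : nat) (y : plane * measurableTypeR R * measurableTypeR R) :=
  translate (flow (a n) (b n) y.1.1) (s * y.1.2, s * y.2).

Let mflow n : measurable_fun setT (flow (a n) (b n)).
Proof. by have [? _ _ _] := aM n; have [? _ _ _] := bM n; exact: measurable_flow. Qed.

Let mnoise_step n : measurable_fun setT (noise_step n).
Proof.
have mf : measurable_fun setT (fun y : plane * measurableTypeR R * measurableTypeR R =>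
    (flow (a n) (b n) y.1.1, (s * y.1.2, s * y.2) : plane)).
  apply: measurable_fun_pair.
    apply: (measurableT_comp (mflow n)).
    exact: (measurableT_comp measurable_fst measurable_fst).
  apply: measurable_fun_pair; apply: measurable_funM => //.
  exact: (measurableT_comp measurable_snd measurable_fst).
exact: (measurableT_comp measurable_translate mf).
Qed.

(** The next state is a function of the present one and of the two innovations of time [n], which
    are absorbed one after the other. Measurability is proved alongside because each absorption
    requires it. *)
Lemma chain_indep n :
  measurable_fun setT (chain n) /\ indep_from P xi (chain n) (future n).
Proof.
elim: n => [|n [mX iX]].
  by split; [exact: measurable_cst|exact: indep_from_cst].
have mxi' j : measurable_fun setT (xi j : Omega -> measurableTypeR R).
  exact: mxi.
have mX1 : measurable_fun setT
    (fun w => (chain n w, xi (true, n) w) : plane * measurableTypeR R).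
  exact: measurable_fun_pair mX (mxi' _).
have mX2 : measurable_fun setT (fun w => ((chain n w, xi (true, n) w),
    xi (false, n) w) : plane * measurableTypeR R * measurableTypeR R).
  exact: measurable_fun_pair mX1 (mxi' _).
have i1 := indep_from_pair mxi mX iX (j := (true, n)) (leqnn n).
have i2 := indep_from_pair mxi mX1 i1 (j := (false, n)) (leqnn n).
split; first exact: (measurableT_comp (mnoise_step n) mX2).
apply: (indep_from_sub _ (indep_from_comp (mnoise_step n) i2)).
move=> [c m]; rewrite !inE/= !xpair_eqE => nm.
by rewrite (gtn_eqF nm) !andbF; exact: ltnW.
Qed.

Lemma measurable_chain n : measurable_fun setT (chain n).
Proof. by have [] := chain_indep n. Qed.

(** The Markov property in integrated form. The second innovation is integrated out first, with the
    state and the first innovation as its past; then the first one. *)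
Lemma ge0_integral_chainS n (h : plane -> \bar R) : measurable_fun setT h ->
  (forall x, (0 <= h x)%E) ->
  (\int[P]_w h (chain n.+1 w) =
   \int[P]_w \int[noise s]_z h (translate (flow (a n) (b n) (chain n w)) z))%E.
Proof.
move=> mh h0; have [mX iX] := chain_indep n.
have mX1 : measurable_fun setT
    (fun w => (chain n w, xi (true, n) w) : plane * measurableTypeR R).
  have m : measurable_fun setT (xi (true, n) : Omega -> measurableTypeR R).
    exact: mxi.
  exact: measurable_fun_pair mX m.
have i1 := indep_from_pair mxi mX iX (j := (true, n)) (leqnn n).
have mhs : measurable_fun setT (fun y => h (noise_step n y)).
  exact: (measurableT_comp mh (mnoise_step n)).
rewrite (ge0_integral_indep mxi mX1 i1 (j := (false, n)) (leqnn n)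
  (xi_law (false, n)) mhs)//.
have mF := measurable_fun_fubini_tonelli_F (m2 := @std_normal R)
  (fun y => h (noise_step n y)) mhs (fun y => h0 _).
have F0 x : (0 <= fubini_F (@std_normal R) (fun y => h (noise_step n y)) x)%E.
  exact: integral_ge0.
rewrite (ge0_integral_indep mxi mX iX (j := (true, n)) (leqnn n)
  (xi_law (true, n)) mF)//.
apply: eq_integral => w _; set x := flow _ _ _.
have mhx : measurable_fun setT (fun z => h (translate x z)).
  apply: (measurableT_comp mh).
  exact: (measurableT_comp measurable_translate (measurable_pair1 x)).
rewrite ge0_integral_law// fubini_tonelli1//.
exact: (measurableT_comp mhx (measurable_scale_pair s)).
Qed.

Section coordinate.
Variable pr : plane -> R.
Hypothesis mpr : measurable_fun setT pr.
Hypothesis prD : forall x z, pr (translate x z) = pr x + pr z.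
Hypothesis ipr : (noise s).-integrable setT (fun z => (pr z)%:E).
Hypothesis ipr2 : (noise s).-integrable setT (fun z => (pr z ^+ 2)%:E).
Hypothesis pr0 : \int[noise s]_z pr z = 0.
Hypothesis drift : forall n,
  centered_periodic M (fun x => pr (flow (a n) (b n) x) - pr x).

(* Backward induction from the final time: the corrector [psi] solves
   [psi_k = drift_k + smoothing psi_(k+1) \o flow_k], so that [pr X_k + psi_k X_k]
   is a martingale; the contraction keeps all correctors below [L = M / c]. *)
Lemma chain_coordinate_moment : exists C : R, forall n,
  (\int[P]_w (pr (chain n w) ^+ 2)%:E <= (C + n%:R * C)%:E)%E.
Proof.
have [c c0 cP] := noise_ge_uniform s0.
have M0 : 0 <= M by have [_ /(_ 0) + _ _] := aM 0; exact: le_trans.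
pose L := M / c.
have L0 : 0 <= L by rewrite divr_ge0// ltW.
pose V := 2 * (\int[noise s]_z (pr z ^+ 2) + L ^+ 2).
have V0 : 0 <= V.
  rewrite mulr_ge0// addr_ge0 ?sqr_ge0//.
  by apply: Rintegral_ge0 => x _; exact: sqr_ge0.
(* [k] is the present time and [m] the number of remaining steps; the induction on [m] keeps [k]
   general, since the hypothesis is used at [k.+1]. *)
have key m k : exists2 psi, centered_periodic L psi &
    (\int[P]_w (pr (chain (k + m) w) ^+ 2)%:E <=
     \int[P]_w ((pr (chain k w) + psi (chain k w)) ^+ 2)%:E + (m%:R * V)%:E)%E.
  elim: m k => [|m IHm] k.
    exists (fun=> 0); first exact: centered_periodic0.
    rewrite addn0 mul0r adde0 le_eqVlt; apply/orP; left.
    by apply/eqP; apply: eq_integral => w _; rewrite addr0.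
  have [psi hpsi le1] := IHm k.+1.
  exists (fun x => (pr (flow (a k) (b k) x) - pr x)
                   + smoothing s psi (flow (a k) (b k) x)).
    (* [L] is the fixed point of the recursion of bounds: [M] from the drift, plus the contracted
       bound of the next corrector. *)
    have -> : L = M + (1 - c) * L by rewrite /L; field; rewrite gt_eqF.
    apply: centered_periodicD; first exact: drift.
    apply: (centered_periodic_flow (f := smoothing s psi) (aM k) (bM k)).
    exact: (centered_periodic_smoothing cP).
  rewrite -addSnnS; apply: (le_trans le1).
  rewrite -natr1 mulrDl mul1r (addrC (m%:R * V)) EFinD addeA leeD2r//.
  have [mpsi psiL _ _ _] := hpsi; have [ms _ _ _ _] :=
    centered_periodic_smoothing cP hpsi.
  have mc := measurable_chain k.
  rewrite (ge0_integral_chainS k (h := fun x => ((pr x + psi x) ^+ 2)%:E)); last 2 first.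
  - apply/measurable_EFinP/measurable_funX; exact: measurable_funD.
  - by move=> x; rewrite lee_fin sqr_ge0.
  have -> : V%:E = (\int[P]_w V%:E)%E.
    by rewrite integral_cst// [X in (_ * X)%E](probability_setT P) mule1.
  have mfc := measurableT_comp (mflow k) mc.
  have mpsi' : measurable_fun setT (fun w => pr (chain k w)
      + (pr (flow (a k) (b k) (chain k w)) - pr (chain k w)
         + smoothing s psi (flow (a k) (b k) (chain k w)))).
    apply: measurable_funD; first exact: (measurableT_comp mpr mc).
    apply: measurable_funD; last exact: (measurableT_comp ms mfc).
    apply: measurable_funB; first exact: (measurableT_comp mpr mfc).
    exact: (measurableT_comp mpr mc).
  have msq : measurable_fun setT (fun w => ((pr (chain k w)
      + (pr (flow (a k) (b k) (chain k w)) - pr (chain k w)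
         + smoothing s psi (flow (a k) (b k) (chain k w)))) ^+ 2)%:E).
    exact/measurable_EFinP/measurable_funX.
  rewrite -ge0_integralD//; last by move=> w _; rewrite lee_fin sqr_ge0.
  apply: ge0_le_integral => //.
  - by move=> w _; apply: integral_ge0 => z _; rewrite lee_fin sqr_ge0.
  - apply: (measurable_fun_fubini_tonelli_F (m2 := noise s)
      (fun y => ((pr (translate (flow (a k) (b k) (chain k y.1)) y.2)
        + psi (translate (flow (a k) (b k) (chain k y.1)) y.2)) ^+ 2)%:E)).
      have mt : measurable_fun setT (fun y : Omega * plane =>
          translate (flow (a k) (b k) (chain k y.1)) y.2).
        apply: (measurableT_comp measurable_translate
          (g := fun y : Omega * plane => (flow (a k) (b k) (chain k y.1), y.2))).
        apply: measurable_fun_pair => //.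
        exact: (measurableT_comp mfc measurable_fst).
      apply/measurable_EFinP/measurable_funX.
      by apply: measurable_funD; [exact: (measurableT_comp mpr mt)
                                 |exact: (measurableT_comp mpsi mt)].
    by move=> y; rewrite lee_fin sqr_ge0.
  - by apply: emeasurable_funD.
  move=> w _; set x := chain k w; set y := flow (a k) (b k) x.
  under eq_integral do rewrite prD.
  have mpy : measurable_fun setT (fun z : plane => psi (translate y z)).
    apply: (measurableT_comp mpsi).
    exact: (measurableT_comp measurable_translate (measurable_pair1 y)).
  have bpy : bounded_measurable (fun z : plane => psi (translate y z)).
    by split => //; exists L.
  (* The noise average of [psi (translate y z)] is [smoothing s psi y], and [pr y] is [pr x] plus
     the drift, so the square in the bound is that of [pr x] plus the new corrector at [x]. *)
  have := second_moment_le mpr ipr ipr2 pr0 (pr y) bpy (fun z => psiL _).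
  move=> /le_trans; apply.
  by rewrite -EFinD lee_fin addrA subrKC.
have C0 := sqr_ge0 (`|pr x0| + L).
exists ((`|pr x0| + L) ^+ 2 + V) => n; have [psi [_ psiL _ _ _]] := key n 0%N.
have -> : (\int[P]_w ((pr (chain 0 w) + psi (chain 0 w)) ^+ 2)%:E =
    ((pr x0 + psi x0) ^+ 2)%:E)%E.
  rewrite -[LHS]/(\int[P]_w (cst ((pr x0 + psi x0) ^+ 2)%:E w))%E integral_cst//.
  by rewrite [X in (_ * X)%E](probability_setT P) mule1.
rewrite add0n => /le_trans; apply.
rewrite -EFinD lee_fin.
have : (pr x0 + psi x0) ^+ 2 <= (`|pr x0| + L) ^+ 2.
  rewrite -(real_normK (num_real (_ + _))) lerXn2r ?nnegrE ?addr_ge0//.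
  by rewrite (le_trans (ler_normD _ _))// lerD.
have : 0 <= n%:R :> R by [].
nra.
Qed.

End coordinate.

End chain.

(** * Regularity of the velocity field *)

Section velocity_field.
Context {R : realType}.
Local Notation mu := (@lebesgue_measure R).
Implicit Types f : R -> R.

Lemma Rintegral_uniform01 f : bounded_measurable f ->
  \int[uniform01]_x f x = \int[mu]_(x in `[0, 1]) f x.
Proof.
move=> bf; have [mf [M fM]] := bf.
have bM := bounded_measurable_cst (measurableTypeR R) M.
have int01 g : bounded_measurable g ->
    mu.-integrable `[0%R, 1%R] (EFin \o g).
  move=> [mg [K gK]]; apply: measurable_bounded_integrable => //.
  - by rewrite /= lebesgue_measure_itv/= lte_fin ltr01 -EFinB ltry.
  - exact: measurable_funTS.
  - exists K; split; first exact: num_real.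
    by move=> y Ky x _; exact: le_trans (gK x) (ltW Ky).
have : \int[uniform01]_x (f x + M) = \int[mu]_(x in `[0, 1]) (f x + M).
  rewrite /Rintegral integral_uniform ?subr0 ?invr1 ?mul1e//.
  - by apply/measurable_EFinP/measurable_funD.
  - move=> x; rewrite lee_fin; have := fM x; rewrite ler_norml => /andP[]; lra.
rewrite RintegralD//; try exact: bounded_measurable_integrable.
rewrite RintegralD//; [|exact: int01|exact: int01].
rewrite Rintegral_probability_cst Rintegral_cst//= lebesgue_measure_itv/=.
by rewrite lte_fin ltr01 -EFinB/= subr0 mulr1 => /addIr.
Qed.

Lemma periodic_bounded f : continuous f -> (forall x, f (x + 1) = f x) ->
  exists M, forall x, `|f x| <= M.
Proof.
move=> cf fp; have cn : continuous (fun x => `|f x|).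
  by move=> x; apply: (continuous_comp (cf x)); exact: norm_continuous.
have cw : {within `[0, 1], continuous (fun x => `|f x|)}.
  exact: continuous_subspaceT.
have [c _ cM] := EVT_max ler01 cw.
exists `|f c| => x; have [r /andP[r0 r1] fr] := periodic_frac x fp.
have := fr 0; rewrite !add0r => ->; apply: cM.
by rewrite in_itv/= r0 ltW.
Qed.

(** Advancing [n] by [N] advances the half-time by exactly one period, so only [N] velocity profiles
    occur, each continuous and periodic. *)
Lemma thalf_bounded (v : R -> R -> R) (N : nat) : (0 < N)%N ->
  (forall t, continuous (v t)) -> (forall t x, v (t + 1) x = v t x) ->
  (forall t x, v t (x + 1) = v t x) ->
  exists M, forall n x, `|v (thalf N n) x| <= M.
Proof.
move=> N0 cv vt vx.
have bounded_upto m : exists M, forall k x, (k < m)%N -> `|v (thalf N k) x| <= M.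
  elim: m => [|m [M IH]]; first by exists 0.
  have [K vK] := periodic_bounded (cv (thalf N m)) (vx (thalf N m)).
  exists (Num.max M K) => k x; rewrite ltnS leq_eqVlt le_max => /predU1P[->|km].
    by rewrite vK orbT.
  by rewrite IH.
have [M vM] := bounded_upto N; exists M => n x.
have -> : thalf N n = thalf N (n %% N) + (n %/ N)%:Z%:~R :> R.
  rewrite /thalf /dtN {1}(divn_eq n N) natrD natrM -pmulrn.
  by field; rewrite pnatr_eq0 -lt0n.
rewrite (periodic_int (f := fun t => v t x))// vM//.
by rewrite ltn_mod.
Qed.

(** Stated through increments so as to cover both a translated argument and functions differing by a
    constant. *)
Lemma derive1_congr f g (x y : R) :
  (forall h, f (h + x) - f x = g (h + y) - g y) ->
  derive1 f x = derive1 g y.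
Proof.
move=> fg; rewrite /derive1.
by under eq_fun do rewrite fg.
Qed.

(** Matching increments rather than values lets [f] be one summand of [F] along a line on which the
    other summand is constant. *)
Lemma continuous_derive1_section (F : 'rV[R]_3 -> R) (i : 'I_3) (p : 'rV[R]_3) f :
  continuous (fun x => 'D_(delta_mx 0 i) F x) ->
  (forall h x, f (h + x) - f x =
    F (h *: delta_mx 0 i + (p + x *: delta_mx 0 i)) - F (p + x *: delta_mx 0 i)) ->
  continuous (derive1 f).
Proof.
move=> cF fF.
have -> : derive1 f = (fun x => 'D_(delta_mx 0 i) F (p + x *: delta_mx 0 i)).
  apply/funext => x; rewrite /derive1 /derive.
  by under eq_fun do rewrite fF.
have cp : continuous (fun x : R => p + x *: delta_mx 0 i : 'rV[R]_3).
  move=> x; apply: cvgD; first exact: cvg_cst.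
  by apply: cvgZr_tmp; exact: cvg_id.
by move=> x; exact: (continuous_comp (cp x) (cF _)).
Qed.

(** The factor [sgn] serves both velocities, which carry opposite signs; the time step [dt] is
    included in the displacement. *)
Lemma velocity_of_potential (H : R -> R -> R) (sgn dt M : R) (t : R) :
  continuous (derive1 (H t)) -> (forall x, H t (x + 1) = H t x) ->
  (forall x, `|sgn * derive1 (H t) x| * `|dt| <= M) ->
  \int[mu]_(x in `[0, 1]) (sgn * derive1 (H t) x) = 0 ->
  velocity M (fun x => sgn * derive1 (H t) x * dt).
Proof.
move=> cH Hp HM H0.
have mv : measurable_fun setT (derive1 (H t) : R -> R).
  exact: continuous_measurable_fun.
have vp x : derive1 (H t) (x + 1) = derive1 (H t) x.
  by apply: derive1_congr => h; rewrite addrA !Hp.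
have [K vK] := periodic_bounded cH vp.
have bv : bounded_measurable (fun x => sgn * derive1 (H t) x).
  split; first exact: measurable_funM.
  exists (`|sgn| * K) => x; rewrite normrM ler_wpM2l//.
split => [|x|x|].
- by apply: measurable_funM => //; case: bv.
- by rewrite normrM.
- by rewrite vp.
- rewrite RintegralZr//; last exact: (bounded_measurable_integrable uniform01).
  by rewrite Rintegral_uniform01// H0 mul0r.
Qed.

End velocity_field.

Section smooth_sections.
Context {R : realType} (H1 H2 : R -> R -> R).

Lemma smooth_continuous_derive1 :
  smooth (fun v : 'rV[R]_3 => H1 (v 0 0) (v 0 1) + H2 (v 0 0) (v 0 2)) ->
  (forall t, continuous (derive1 (H1 t))) /\
  (forall t, continuous (derive1 (H2 t))).
Proof.
move=> /(_ 1%N)[_ HD]; split=> t.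
  have [_ [cD _]] := HD 1.
  apply: (continuous_derive1_section (p := t *: delta_mx 0 0) cD) => h x.
  rewrite !mxE !eqxx /= !(mulr0, mulr1, add0r, addr0); ring.
have [_ [cD _]] := HD 2.
apply: (continuous_derive1_section (p := t *: delta_mx 0 0) cD) => h x.
rewrite !mxE !eqxx /= !(mulr0, mulr1, add0r, addr0); ring.
Qed.

End smooth_sections.

Unset Implicit Arguments.

Theorem theorem4p5 (R : realType) (sigma : R) (H1 H2 : R -> R -> R)
  (N : nat) (x0 : R * R)
  (d : measure_display) (Omega : measurableType d) (P : probability Omega R)
  (xi1 xi2 : nat -> {RV P >-> R}) :
  0 < sigma ->
  (* H(t,x1,x2) = H1(t,x1) + H2(t,x2) is smooth on R^3 *)
  smooth (fun v : 'rV[R]_3 => H1 (v 0 0) (v 0 1) + H2 (v 0 0) (v 0 2)) ->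
  (* H is 1-periodic in t, x1 and x2 *)
  (forall t x1 x2, H1 (t + 1) x1 + H2 (t + 1) x2 = H1 t x1 + H2 t x2) ->
  (forall t x1 x2, H1 t (x1 + 1) + H2 t x2 = H1 t x1 + H2 t x2) ->
  (forall t x1 x2, H1 t x1 + H2 t (x2 + 1) = H1 t x1 + H2 t x2) ->
  (* v1 = - dH/dx2, v2 = dH/dx1 have zero mean over a period *)
  (forall t, (\int[(@lebesgue_measure R)]_(x in `[0%R, 1%R]) (- derive1 (H2 t) x)%:E = 0)%E) ->
  (forall t, (\int[(@lebesgue_measure R)]_(x in `[0%R, 1%R]) (derive1 (H1 t) x)%:E = 0)%E) ->
  (0 < N)%N ->
  (* xi1^n, xi2^n are i.i.d. N(0,1) *)
  (forall n, std_normal_law P (xi1 n)) ->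
  (forall n, std_normal_law P (xi2 n)) ->
  mutually_independent P
    (fun j : bool * nat => if j.1 then (xi1 j.2 : Omega -> R)
                           else (xi2 j.2 : Omega -> R)) ->
  exists C : R, forall n : nat, (1 <= n)%N ->
    (\int[P]_w
       (((scheme (fun t x2 => - derive1 (H2 t) x2) (fun t x1 => derive1 (H1 t) x1)
            sigma N x0 (fun m => (xi1 m : Omega -> R)) (fun m => (xi2 m : Omega -> R)) n w).1 ^+ 2
         + (scheme (fun t x2 => - derive1 (H2 t) x2) (fun t x1 => derive1 (H1 t) x1)
            sigma N x0 (fun m => (xi1 m : Omega -> R)) (fun m => (xi2 m : Omega -> R)) n w).2 ^+ 2)%:E)
     <= (C * n%:R)%:E)%E.
Proof.
move=> sigma0 Hsmooth Ht Hx1 Hx2 mean2 mean1 N0 law1 law2 indep.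
have [cD1 cD2] := smooth_continuous_derive1 Hsmooth.
have p1 t x : H1 t (x + 1) = H1 t x by apply: (addIr (H2 t 0)); exact: Hx1.
have p2 t x : H2 t (x + 1) = H2 t x by apply: (addrI (H1 t 0)); exact: Hx2.
have t1 t x : derive1 (H1 (t + 1)) x = derive1 (H1 t) x.
  (* Periodicity of the sum in time makes [H1 (t + 1)] equal to [H1 t] only up to a constant in [x],
     which the increments cancel. *)
  by apply: derive1_congr => h; have := Ht t (h + x) 0; have := Ht t x 0; lra.
have t2 t x : derive1 (H2 (t + 1)) x = derive1 (H2 t) x.
  by apply: derive1_congr => h; have := Ht t 0 (h + x); have := Ht t 0 x; lra.
have dp1 t x : derive1 (H1 t) (x + 1) = derive1 (H1 t) x.
  by apply: derive1_congr => h; rewrite addrA !p1.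
have dp2 t x : derive1 (H2 t) (x + 1) = derive1 (H2 t) x.
  by apply: derive1_congr => h; rewrite addrA !p2.
have [M1 M1P] := thalf_bounded N0 cD1 t1 dp1.
have [M2 M2P] := thalf_bounded N0 cD2 t2 dp2.
set v1 := fun t x2 => - derive1 (H2 t) x2.
set v2 := fun t x1 => derive1 (H1 t) x1.
set dt : R := dtN N.
pose M := Num.max M1 M2 * `|dt|.
pose a n x := v1 (thalf N n) x * dt.
pose b n x := v2 (thalf N n) x * dt.
have aM n : velocity M (a n).
  have -> : a n = fun x => - 1 * derive1 (H2 (thalf N n)) x * dt.
    by apply/funext => x; rewrite mulN1r.
  apply: velocity_of_potential => //.
  - by move=> x; rewrite mulN1r normrN ler_wpM2r// le_max M2P orbT.
  - rewrite -[RHS]/(fine 0%E) -(mean2 (thalf N n)); congr fine.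
    by apply: eq_integral => x _; rewrite mulN1r.
have bM n : velocity M (b n).
  have -> : b n = fun x => 1 * derive1 (H1 (thalf N n)) x * dt.
    by apply/funext => x; rewrite mul1r.
  apply: velocity_of_potential => //.
  - by move=> x; rewrite mul1r ler_wpM2r// le_max M1P.
  - rewrite -[RHS]/(fine 0%E) -(mean1 (thalf N n)); congr fine.
    by apply: eq_integral => x _; rewrite mul1r.
pose s := sigma * Num.sqrt dt.
have s0 : 0 < s by rewrite mulr_gt0// sqrtr_gt0 invr_gt0 ltr0n.
pose xi := fun j : bool * nat =>
  if j.1 then (xi1 j.2 : Omega -> R) else (xi2 j.2 : Omega -> R).
have mxi j : measurable_fun setT (xi j) by rewrite /xi; case: ifP.
have xi_law j A : measurable A -> P (xi j @^-1` A) = std_normal A.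
  by move=> mA; rewrite /xi; case: ifP => _; [exact: law1|exact: law2].
have schemeE n w : scheme v1 v2 sigma N x0 (fun m => (xi1 m : Omega -> R))
    (fun m => (xi2 m : Omega -> R)) n w = chain xi s a b x0 n w.
  by elim: n => [//|n IHn] /=; rewrite IHn.
have [C1 C1P] := chain_coordinate_moment x0 s0 mxi xi_law indep aM bM
  measurable_fst (fun _ _ => erefl) (noise_integrable_fst s)
  (noise_integrable_fst_sqr s) (noise_mean_fst s)
  (fun n => centered_periodic_drift1 (b n) (aM n)).
have [C2 C2P] := chain_coordinate_moment x0 s0 mxi xi_law indep aM bM
  measurable_snd (fun _ _ => erefl) (noise_integrable_snd s)
  (noise_integrable_snd_sqr s) (noise_mean_snd s)
  (fun n => centered_periodic_drift2 (aM n) (bM n)).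
(* The bound at time 0 has a nonnegative left side, which forces the constants to be nonnegative. *)
have ge0 (C : R) (f : Omega -> R) :
    (\int[P]_w (f w ^+ 2)%:E <= (C + 0%:R * C)%:E)%E -> 0 <= C.
  rewrite mul0r addr0 -lee_fin; apply: le_trans.
  by apply: integral_ge0 => w _; rewrite lee_fin sqr_ge0.
have C10 := ge0 _ _ (C1P 0%N).
have C20 := ge0 _ _ (C2P 0%N).
(* For [n] at least 1, each [C + n%:R * C] is at most [2 * C * n%:R]. *)
exists (2 * (C1 + C2)) => n n1.
under eq_integral do rewrite !schemeE EFinD.
have mc := measurable_chain s x0 mxi indep aM bM n.
rewrite ge0_integralD//; last 4 first.
- by move=> w _; rewrite lee_fin sqr_ge0.
- apply/measurable_EFinP/measurable_funX.
  exact: (measurableT_comp measurable_fst mc).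
- by move=> w _; rewrite lee_fin sqr_ge0.
- apply/measurable_EFinP/measurable_funX.
  exact: (measurableT_comp measurable_snd mc).
apply: (le_trans (leeD (C1P n) (C2P n))).
rewrite -EFinD lee_fin.
have : 1 <= n%:R :> R by rewrite ler1n.
nra.
Qed.
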